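(* Let $d\ge 2$, and let $k,n$ be integers such that either (i) $k=d-1$ and $n\ge d+2$, or (ii) $1\le k\le d-2$ and $n\ge d+1$. Let $\Delta_{n,k}$ denote the complete $k$-dimensional simplicial complex on $n$ vertices (all subsets of an $n$-element set of size at most $k+1$). Then $$\operatorname{rank}(\mathcal{M}_{k,d}(\Delta_{n,k}))=dn-\binom{d+1}{2}.$$
   Context: For a simplicial complex $X$, $X_i$ denotes its set of $i$-dimensional faces (faces of size $i+1$), and $X_0$ is its vertex set. For $k\le d$ and a $k$-dimensional complex $X$, given an embedding $\mathbf{p}\in(\mathbb{R}^d)^{|X_0|}$ of the vertices, let $v_X:(\mathbb{R}^d)^{|X_0|}\to\mathbb{R}^{|X_k|}$ be the map sending $\mathbf{p}$ to the vector whose $\sigma$-coordinate ($\sigma\in X_k$) is the squared $k$-dimensional volume of the convex hull of $\mathbf{p}(\sigma)$. The $(k,d)$-volume rigidity matrix $\mathcal{B}(X,\mathbf{p})$ is the $|X_k|\times d|X_0|$ Jacobian matrix of $v_X$ at $\mathbf{p}$. The $(k,d)$-volume rigidity matroid $\mathcal{M}_{k,d}(X)$ is the matroid on ground set $X_k$ whose independent sets are the sets of $k$-simplices whose rows in $\mathcal{B}(X,\mathbf{p})$ are linearly independent, for a generic $\mathbf{p}$ (i.e. the $d|X_0|$ coordinates of $\mathbf{p}$ are algebraically independent over $\mathbb{Q}$). Thus its rank is the rank of $\mathcal{B}(X,\mathbf{p})$ for generic $\mathbf{p}$. *)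

(* Defs.v *)
From mathcomp Require Import all_boot all_order all_algebra.
From mathcomp Require Import reals topology normedtype derive.
(* The notations of mpoly clash with those of MathComp-Analysis. *)
From mathcomp Require Import -(notations) mpoly.

Set Implicit Arguments.
Unset Strict Implicit.
Unset Printing Implicit Defensive.

Import GRing.Theory Num.Theory numFieldNormedType.Exports.
Local Open Scope ring_scope.

(* A finite matroid, given by its independent sets; the ground set is the whole
   finite type E. *)
Record matroid (E : finType) := Matroid {
  indep :> pred {set E};
  indep0 : indep set0;
  indep_sub : forall I J : {set E}, I \subset J -> indep J -> indep I;
  indep_aug : forall I J : {set E}, indep I -> indep J -> (#|I| < #|J|)%N ->
    exists2 x, x \in J :\: I & indep (x |: I)
}.

Definition matroid_rank (E : finType) (M : matroid E) : nat :=
  \max_(I : {set E} | M I) #|I|.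

Section LinearMatroid.
Variables (E : finType) (K : fieldType) (V : vectType K) (f : E -> V).

(* The image sequence keeps repetitions, so a set containing two elements with
   the same image is dependent. *)
Definition lin_indep : pred {set E} := fun I => free [seq f x | x in I].

Lemma lin_indep0 : lin_indep set0.
Proof. by rewrite /lin_indep /image_mem enum_set0 nil_free. Qed.

Lemma lin_indep_sub (I J : {set E}) :
  I \subset J -> lin_indep J -> lin_indep I.
Proof.
rewrite /lin_indep => sIJ.
have eqJ : perm_eq (enum J) (enum I ++ enum (J :\: I)).
  apply: uniq_perm; first exact: enum_uniq.
    rewrite cat_uniq !enum_uniq andbT /=; apply/hasPn => x.
    by rewrite !mem_enum inE => /andP[].
  move=> x; rewrite mem_cat !mem_enum !inE.
  by case: (boolP (x \in I)) => //= /(subsetP sIJ).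
rewrite (perm_free (perm_map f eqJ)) map_cat.
exact: catl_free.
Qed.

Lemma lin_indep_aug (I J : {set E}) :
  lin_indep I -> lin_indep J -> (#|I| < #|J|)%N ->
  exists2 x, x \in J :\: I & lin_indep (x |: I).
Proof.
rewrite /lin_indep => fI fJ ltIJ.
have [/exists_inP[x xJ xNI]|] :=
    boolP [exists x in J, f x \notin <<[seq f y | y in I]>>%VS].
  have xI : x \notin I.
    by apply: contra xNI => xI; apply: memv_span; apply: image_f.
  exists x; first by rewrite inE xI.
  have eqI : perm_eq (enum (x |: I)) (x :: enum I).
    apply: uniq_perm; rewrite ?enum_uniq //= ?mem_enum ?xI ?enum_uniq // => y.
    by rewrite !(mem_enum, inE).
  by rewrite (perm_free (perm_map f eqI)) /= free_cons xNI.
rewrite negb_exists_in => /forall_inP sJI.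
have: (\dim <<[seq f y | y in J]>> <= \dim <<[seq f y | y in I]>>)%N.
  apply/dimvS/span_subvP => v /imageP[x xJ ->].
  by have := sJI x xJ; rewrite negbK.
by rewrite (eqP fI) (eqP fJ) !size_image leqNgt ltIJ.
Qed.

Definition linear_matroid : matroid E :=
  Matroid lin_indep0 lin_indep_sub lin_indep_aug.

End LinearMatroid.

(* A simplicial complex with vertex set 'I_n: every vertex is a face. *)
Record complex (n : nat) := Complex {
  complex_set :> {set {set 'I_n}};
  complex_vertex : forall v : 'I_n, [set v] \in complex_set;
  complex_down : forall s t : {set 'I_n},
    s \subset t -> t \in complex_set -> s \in complex_set
}.

Definition faces (n : nat) (X : complex n) (k : nat) : {set {set 'I_n}} :=
  [set s in (X : {set {set 'I_n}}) | #|s| == k.+1].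

Definition face (n : nat) (X : complex n) (k : nat) : finType :=
  {s : {set 'I_n} | s \in faces X k}.

Section CompleteComplex.
Variables n k : nat.

Definition complete_set : {set {set 'I_n}} := [set s : {set 'I_n} | (#|s| <= k.+1)%N].

Lemma complete_vertex (v : 'I_n) : [set v] \in complete_set.
Proof. by rewrite inE cards1. Qed.

Lemma complete_down (s t : {set 'I_n}) :
  s \subset t -> t \in complete_set -> s \in complete_set.
Proof. by rewrite !inE => /subset_leq_card; apply: leq_trans. Qed.

Definition complete_complex : complex n :=
  Complex complete_vertex complete_down.

End CompleteComplex.

Section VolumeRigidity.
Variable R : realType.

Definition alg_indep_over_rat (m : nat) (x : 'I_m -> R) : Prop :=
  forall q : mpoly m rat, q != 0 -> meval x (map_mpoly (ratr : rat -> R) q) != 0.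

(* A vertex map p into R^d is an n x d matrix; row v p is the point p(v). *)
Definition generic (n d : nat) (p : 'M[R]_(n, d)) : Prop :=
  alg_indep_over_rat (fun i : 'I_(n * d) => mxvec p ord0 i).

Definition edge_mx (d : nat) (s : seq 'rV[R]_d) : 'M[R]_((size s).-1, d) :=
  \matrix_(i < (size s).-1) (s`_i.+1 - s`_0).

(* The k-dimensional volume of the convex hull of the k+1 points s_0, ..., s_k
   of R^d is sqrt (det (A A^T)) / k!, where A is the k x d matrix with rows
   s_i - s_0 (Gram determinant formula); it does not depend on the order of
   the points. *)
Definition simplex_volume (d : nat) (s : seq 'rV[R]_d) : R :=
  Num.sqrt (\det (edge_mx s *m (edge_mx s)^T)) / ((size s).-1)`!%:R.

Variables (n : nat) (X : complex n) (k d : nat).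

(* The domain (R^d)^n is flattened to row vectors by mxvec / vec_mx, and the
   codomain is indexed by the enumeration of the k-faces. *)
Definition sq_volume_map (x : 'rV[R]_(n * d)) : 'rV[R]_#|face X k| :=
  \row_(i < #|face X k|)
    simplex_volume [seq row v (vec_mx x) | v in val (enum_val i)] ^+ 2.

(* MathComp-Analysis acts on row vectors, so its Jacobian has one column per
   output coordinate; transposing puts one row per k-face. *)
Definition rigidity_mx (p : 'M[R]_(n, d)) : 'M[R]_(#|face X k|, n * d) :=
  (jacobian sq_volume_map (mxvec p))^T.

Definition rigidity_matroid (p : 'M[R]_(n, d)) : matroid (face X k) :=
  linear_matroid (fun s : face X k => row (enum_rank s) (rigidity_mx p)).

End VolumeRigidity.

(* Main.v *)
Require Import Defs.
From HB Require Import structures.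
From mathcomp Require Import all_boot all_order perm all_algebra reals.
From mathcomp Require Import polyrcf boolp functions topology normedtype derive.
From mathcomp Require Import -(notations) mpoly.
From mathcomp Require Import ring lra zify.

Set Implicit Arguments.
Unset Strict Implicit.
Unset Printing Implicit Defensive.

(* The rank of a matrix of rational polynomials at a generic point is at least
   its rank at any point, so upper and lower bounds can be proved at different
   points.

   Infinitesimal isometries are in the kernel of the rigidity matrix and form a
   space of dimension C(d+1, 2) at a point whose vertices affinely span, which
   a generic point does; this gives the upper bound.

   For the lower bound take a special position q: d + 1 vertices form a regular
   simplex, and the other ones lie at its centre (k = d - 1) or at one of its
   vertices (k <= d - 2). A motion u changes the squared volume of a face
   through the numbers L(a, b) = (q_a - q_b).(u_a - u_b) only, and by symmetry
   the condition given by a face A of the regular simplex reads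
   sum_{a, b in A} L(a, b) = 0, and the one given by the centre c and a set A
   of d - 1 vertices reads 2 (d + 1) sum_{a in A} L(a, c) = sum_{a, b in A} L(a, b).
   These linear systems force L(v, b) = 0 for each vertex v and each vertex b of
   the simplex, hence u is an infinitesimal isometry. *)

Import Order.TTheory GRing.Theory Num.Theory numFieldNormedType.Exports.
Local Open Scope ring_scope.

(** * Volumes and Jacobians of polynomial maps *)

Lemma monic_root_gt (R : rcfType) (p : {poly R}) (a : R) :
  p \is monic -> p.[a] < 0 -> exists2 t, a < t & root p t.
Proof.
move=> pm pa; have lp : lead_coef p = 1 by exact/eqP.
have [n pn] : exists n, forall x, x >= n -> p.[x] >= lead_coef p.
  by apply: poly_pinfty_gt_lc; rewrite lp ltr01.
have pb : 0 <= p.[Num.max a n] by rewrite (le_trans _ (pn _ _)) ?lp ?le_max ?lexx ?orbT.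
have [||t /andP[at_ _] pt] := @poly_ivt R p a (Num.max a n).
- by rewrite le_max lexx.
- by rewrite (ltW pa) pb.
exists t => //; rewrite lt_neqAle at_ andbT; apply: contraTneq pa => ->.
by rewrite (rootP pt) ltxx.
Qed.

Lemma mulmx_tr_ge0 (R : realDomainType) m (v : 'rV[R]_m) : 0 <= (v *m v^T) ord0 ord0.
Proof. by rewrite mxE sumr_ge0 // => i _; rewrite mxE -expr2 sqr_ge0. Qed.

Lemma mulmx_tr_gt0 (R : realDomainType) m (v : 'rV[R]_m) :
  v != 0 -> 0 < (v *m v^T) ord0 ord0.
Proof.
move=> v0; rewrite lt_neqAle mulmx_tr_ge0 andbT; apply: contra v0.
rewrite eq_sym mxE psumr_eq0; last by move=> i _; rewrite mxE -expr2 sqr_ge0.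
move=> /allP v0; apply/eqP/rowP => i; have := v0 i (mem_index_enum _).
by rewrite !mxE mulf_eq0 orbb => /eqP.
Qed.

(** In [t], the determinant of [t + A A^T] is a monic polynomial. Were it negative at 0, it would
    have a root [t > 0], and a kernel vector [v] would satisfy [t |v|^2 + |v A|^2 = 0]. This is what
    removes the square root from squared volumes. *)
Lemma det_gram_ge0 (R : rcfType) m n (A : 'M[R]_(m, n)) : 0 <= \det (A *m A^T).
Proof.
pose p := char_poly (- (A *m A^T)).
have pE t : p.[t] = \det (t%:M + A *m A^T).
  rewrite /p /char_poly -horner_evalE -det_map_mx; congr (\det _).
  apply/matrixP => i j; rewrite !mxE /= horner_evalE.
  by rewrite !hornerE hornerMn hornerX opprK.
have -> : \det (A *m A^T) = p.[0] by rewrite pE raddf0 add0r.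
rewrite leNgt; apply/negP => p0.
have [t t0 /rootP] := monic_root_gt (char_poly_monic _) p0.
rewrite pE => /eqP/det0P[v v0 /(congr1 (mulmx^~ v^T))/matrixP/(_ ord0 ord0)].
rewrite mulmxDr mulmxDl mul0mx mul_mx_scalar -scalemxAl mulmxA -mulmxA -trmx_mul.
rewrite [LHS]mxE [X in X + _]mxE [RHS]mxE => /eqP.
by rewrite gt_eqF // ltr_pwDl ?mulmx_tr_ge0 // mulr_gt0 ?mulmx_tr_gt0.
Qed.

Lemma meval_is_diff (R : realType) (N : nat) (q : mpoly N R) (x : 'rV[R]_N) :
  is_diff x (fun y : 'rV[R]_N => meval (y ord0) q)
    (fun v : 'rV[R]_N => \sum_i v ord0 i * meval (x ord0) (mderiv i q)).
Proof.
pose D q := is_diff x (fun y : 'rV[R]_N => meval (y ord0) q)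
    (fun v : 'rV[R]_N => \sum_i v ord0 i * meval (x ord0) (mderiv i q)).
rewrite -/(D q).
have DC c : D (mpolyC N c).
  rewrite /D [X in is_diff _ X _](_ : _ = cst c); last first.
    by apply/funext => v /=; rewrite mevalC.
  apply: is_diff_eq; apply/funext => v /=.
  by rewrite big1 // => i _; rewrite mderivC meval0 mulr0.
have DD p r : D p -> D r -> D (p + r).
  move=> Dp Dr; rewrite /D.
  rewrite [X in is_diff _ X _](_ : _ = (fun y : 'rV[R]_N => meval (y ord0) p) +
    (fun y : 'rV[R]_N => meval (y ord0) r)); last first.
    by apply/funext => v /=; rewrite mevalD.
  have Dpr := is_diffD Dp Dr; apply: is_diff_eq.
  apply/funext => v; rewrite fctE -big_split /=; apply: eq_bigr => i _.
  by rewrite mderivD mevalD mulrDr.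
have DM p r : D p -> D r -> D (p * r).
  move=> Dp Dr; rewrite /D.
  rewrite [X in is_diff _ X _](_ : _ = (fun y : 'rV[R]_N => meval (y ord0) p) *
    (fun y : 'rV[R]_N => meval (y ord0) r)); last first.
    by apply/funext => v /=; rewrite mevalM.
  have Dpr := is_diffM Dp Dr; apply: is_diff_eq.
  apply/funext => v.
  rewrite -[LHS]/(meval (x ord0) p * (\sum_i v ord0 i * meval (x ord0) (mderiv i r))
    + meval (x ord0) r * (\sum_i v ord0 i * meval (x ord0) (mderiv i p))).
  rewrite !mulr_sumr -big_split /=; apply: eq_bigr => i _.
  rewrite mderivM mevalD !mevalM; ring.
have DX i : D (mpolyX R (mnm1 i)).
  rewrite /D [X in is_diff _ X _](_ : _ = (fun y : 'rV[R]_N => y ord0 i)); last first.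
    by apply/funext => v /=; rewrite mevalXU.
  pose f := fun y : 'rV[R]_N => y ord0 i.
  have fl : linear f by move=> c u v; rewrite /f !mxE.
  pose fM := GRing.isLinear.Build _ _ _ _ _ fl.
  pose F : {linear _ -> _} := HB.pack f fM.
  have cF : continuous F by exact: coord_continuous.
  have dF : is_diff x F F.
    by apply: DiffDef; [exact: linear_differentiable | rewrite diff_lin].
  apply: is_diff_eq; apply/funext => v; rewrite (bigD1 i) //= big1 ?addr0.
    rewrite mderivX /= mnm1E eqxx.
    rewrite (_ : mnm_sub (mnm1 i) (mnm1 i) = mnm0) ?mpolyX0 ?scale1r ?meval1 ?mulr1 //.
    by apply/mnmP => j; rewrite mnmBE subnn mnm0E.
  by move=> j ij; rewrite mderivX mnm1E eq_sym (negPf ij) scale0r meval0 mulr0.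
(* Every polynomial is built from constants and variables by sums and products. *)
rewrite (mpolyE q); apply: (big_ind D).
- by rewrite -mpolyC0; exact: DC.
- exact: DD.
move=> m _; rewrite -mul_mpolyC; apply: (DM); first exact: DC.
rewrite (mpolyXE_id _ m); apply: (big_ind D).
- by rewrite -mpolyC1; exact: DC.
- exact: DM.
move=> i _; elim: (m i) => [|e IH]; first by rewrite expr0 -mpolyC1; exact: DC.
by rewrite exprS; apply: (DM).
Qed.

Lemma jacobian_meval (R : realType) (N M : nat) (q : 'I_M -> mpoly N R) (x : 'rV[R]_N) :
  jacobian (fun y : 'rV[R]_N => \row_(j < M) meval (y ord0) (q j)) x
    = \matrix_(i < N, j < M) meval (x ord0) (mderiv i (q j)).
Proof.
set f := fun y => _.
have dq j := meval_is_diff (q j) x.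
have df : differentiable f x.
  have -> : f = \sum_(j < M) (fun y : 'rV[R]_N => meval (y ord0) (q j) *: delta_mx ord0 j).
    apply/funext => y; rewrite fct_sumE [LHS]row_sum_delta.
    by apply: eq_bigr => j _; rewrite mxE.
  by apply: differentiable_sum => j; apply: differentiableZl; have dj := dq j; exact: ex_diff.
apply/row_matrixP => i; rewrite !rowE -(deriveEjacobian _ df) derive_mx; last exact: diff_derivable.
apply/rowP => j; rewrite !mxE.
under [X in 'D_ _ X x]eq_fun do rewrite mxE.
have dj := dq j; have ex := @ex_diff _ _ _ _ _ _ _ dj; rewrite (deriveE _ ex).
rewrite diff_val; by apply: eq_bigr => l _; rewrite !mxE.
Qed.

(** * Determinants and generic ranks *)

Section DetDerivation.
Variables (A B : comNzRingType) (e : {rmorphism A -> B}) (D : {additive A -> B}).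
Hypothesis DM : forall a b, D (a * b) = D a * e b + e a * D b.

Lemma derivation1 : D 1 = 0.
Proof.
by apply: (addrI (D 1)); rewrite addr0 -{3}[1]mulr1 DM rmorph1 mulr1 mul1r.
Qed.

Lemma derivation_prod (I : eqType) (r : seq I) (F : I -> A) : uniq r ->
  D (\prod_(i <- r) F i) = \sum_(i <- r) D (F i) * \prod_(j <- r | j != i) e (F j).
Proof.
elim: r => [|a r IH] /=; first by rewrite !big_nil derivation1.
move=> /andP[ar ur]; rewrite !big_cons DM eqxx IH //; congr (_ * _ + _).
  rewrite rmorph_prod big_seq [RHS]big_seq_cond; apply: eq_bigl => j.
  by case: eqP => [->|]; rewrite ?(negPf ar) ?andbT.
rewrite mulr_sumr; apply: eq_big_seq => i ir.
rewrite big_cons ifT; first by ring.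
by apply: contraNneq ar => ->.
Qed.

(** Jacobi's formula; later [e] evaluates at a point and [D] is the derivative there in some
    direction. The product rule is applied to each term of the permutation expansion, then the
    permutations with [s i = j] are gathered into a cofactor. *)
Lemma derivation_det n (M : 'M[A]_n) :
  D (\det M) = \sum_i \sum_j D (M i j) * cofactor (map_mx e M) i j.
Proof.
rewrite /determinant raddf_sum.
transitivity (\sum_(s : 'S_n) \sum_i
    D (M i (s i)) * ((-1) ^+ s * \prod_(k | i != k) e (M k (s k)))).
  apply: eq_bigr => s _; rewrite mulr_sign.
  have Dsign (b : bool) x : D (if b then - x else x) = (-1) ^+ b * D x.
    by case: b; rewrite ?raddfN ?expr0 ?expr1 ?mul1r ?mulN1r.
  rewrite Dsign.
  rewrite derivation_prod ?index_enum_uniq // mulr_sumr.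
  apply: eq_bigr => i _; rewrite mulrCA; congr (_ * (_ * _)).
  by apply: eq_bigl => k; rewrite eq_sym.
rewrite exchange_big; apply: eq_bigr => i _ /=.
rewrite (partition_big (fun s : 'S_n => s i) predT) //=.
apply: eq_bigr => j _; rewrite expand_cofactor mulr_sumr.
apply: eq_bigr => s /eqP <-; congr (_ * (_ * _)).
by apply: eq_bigr => k _; rewrite mxE.
Qed.

End DetDerivation.

Lemma rank_minor (F : fieldType) m n (M : 'M[F]_(m, n)) :
  exists f : 'I_(\rank M) -> 'I_m, exists g : 'I_(\rank M) -> 'I_n,
    \det (mxsub f g M) != 0.
Proof.
have fr := maxrowsub_free M.
set f := maxrankfun M in fr.
have ff : row_full (rowsub f M)^T by rewrite /row_full mxrank_tr.
exists f, (fullrankfun ff).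
have := fullrowsub_unit ff; rewrite unitmxE unitfE -det_tr.
rewrite (_ : _^T = mxsub f (fullrankfun ff) M) //.
by apply/matrixP => i j; rewrite !mxE.
Qed.

Lemma minor_rank (F : fieldType) m n r (f : 'I_r -> 'I_m) (g : 'I_r -> 'I_n)
    (M : 'M[F]_(m, n)) : \det (mxsub f g M) != 0 -> (r <= \rank M)%N.
Proof.
move=> d0; have /mxrank_unit <- : mxsub f g M \in unitmx by rewrite unitmxE unitfE.
rewrite mxsubrc (leq_trans (mxrankS (rowsub_sub _ _))) //.
rewrite -mxrank_tr (_ : _^T = rowsub g M^T); last by apply/matrixP => i j; rewrite !mxE.
by rewrite -[leqRHS]mxrank_tr; exact: mxrankS (rowsub_sub _ _).
Qed.

Definition rat_eval (R : realType) N (x : 'I_N -> R) : mpoly N rat -> R :=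
  meval x \o map_mpoly (ratr : rat -> R).

HB.instance Definition _ (R : realType) N (x : 'I_N -> R) :=
  GRing.RMorphism.on (rat_eval x).

(** A minor that is nonzero at [y] is a nonzero polynomial over the rationals, hence it cannot
    vanish at [x]. *)
Lemma generic_rank (R : realType) N (x y : 'I_N -> R) m n (Q : 'M[mpoly N rat]_(m, n)) :
  alg_indep_over_rat x -> (\rank (map_mx (rat_eval y) Q) <= \rank (map_mx (rat_eval x) Q))%N.
Proof.
move=> gx; have [f [g]] := rank_minor (map_mx (rat_eval y) Q).
rewrite -map_mxsub det_map_mx => d0.
apply: (minor_rank (f := f) (g := g)); rewrite -map_mxsub det_map_mx.
by apply: gx; apply: contraNneq d0 => ->; rewrite rmorph0.
Qed.

Lemma free_row_free (K : fieldType) m N (X : m.-tuple 'rV[K]_N) :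
  free X = row_free (\matrix_(i < m) tnth X i).
Proof.
apply/idP/idP.
  move=> /freeP fX; rewrite -kermx_eq0; apply/eqP/row_matrixP => i.
  rewrite row0; set v := row i _.
  have /sub_kermxP : (v <= kermx (\matrix_(i < m) tnth X i))%MS by exact: row_sub.
  rewrite mulmx_sum_row => vX; apply/rowP => j; rewrite [RHS]mxE.
  apply: (fX (v ord0)); rewrite -[RHS]vX; apply: eq_bigr => l _.
  by rewrite rowK (tnth_nth 0).
move=> /row_free_inj inj; apply/freeP => k kX i.
have : (\row_i k i) *m (\matrix_(i < m) tnth X i) = 0 *m (\matrix_(i < m) tnth X i).
  rewrite mul0mx mulmx_sum_row -[RHS]kX; apply: eq_bigr => l _.
  by rewrite rowK mxE (tnth_nth 0).
by move/inj/rowP/(_ i); rewrite !mxE.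
Qed.

(** Independent rows span a subspace of the row space, and conversely a maximal free family of rows
    comes from an independent set of size [\rank B]. *)
Lemma linear_matroid_rank (K : fieldType) (E : finType) N (B : 'M[K]_(#|E|, N)) :
  matroid_rank (linear_matroid (fun s : E => row (enum_rank s) B)) = \rank B.
Proof.
rewrite /matroid_rank; apply/eqP; rewrite eqn_leq; apply/andP; split.
  apply/bigmax_leqP => I /=; rewrite /lin_indep => fI.
  have : free (map_tuple (fun s : E => row (enum_rank s) B) (enum_tuple I)) by [].
  rewrite free_row_free => /eqP <-; apply: mxrankS.
  by apply/row_subP => i; rewrite rowK tnth_map row_sub.
have fr := maxrowsub_free B; set f := maxrankfun B in fr.
have fi : injective f by exact: maxrankfun_inj.
pose g i := enum_val (f i).
have gi : injective g by move=> i j /enum_val_inj /fi.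
apply: leq_trans (leq_bigmax_cond [set g i | i : 'I_(\rank B)] _).
  by rewrite card_imset // card_ord.
rewrite /= /lin_indep.
have pe : perm_eq (enum [set g i | i : 'I_(\rank B)]) (map g (enum 'I_(\rank B))).
  apply: uniq_perm => [||x]; first exact: enum_uniq.
    by rewrite map_inj_uniq //; exact: enum_uniq.
  rewrite mem_enum; apply/imsetP/mapP => -[i _ ->]; exists i => //.
  by rewrite mem_enum.
rewrite (perm_free (perm_map _ pe)).
suff -> : [seq row (enum_rank s) B | s <- map g (enum 'I_(\rank B))] =
   map_tuple (fun i => row (f i) B) (ord_tuple _).
  rewrite free_row_free (_ : \matrix_i _ = rowsub f B) //.
  by apply/row_matrixP => i; rewrite rowK tnth_map tnth_ord_tuple row_rowsub.
by rewrite /= -map_comp; apply: eq_map => i /=; rewrite enum_valK.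
Qed.

(** * The rigidity matrix *)

(** Taken over any ring, so that it serves both for indeterminate coordinates and for real ones. *)
Definition gram_mx (K : comNzRingType) n d (x : 'M[K]_(n, d)) (v : 'I_n) (t : seq 'I_n) :
    'M[K]_(size t) :=
  \matrix_(i, j) \sum_c (x (nth v t i) c - x v c) * (x (nth v t j) c - x v c).

Lemma map_gram_mx (K L : comNzRingType) (f : {rmorphism K -> L}) n d (x : 'M[K]_(n, d)) v t :
  map_mx f (gram_mx x v t) = gram_mx (map_mx f x) v t.
Proof.
apply/matrixP => i j; rewrite !mxE rmorph_sum; apply: eq_bigr => c _.
by rewrite rmorphM !rmorphB !mxE.
Qed.

(* Half the derivative, in direction u, of the squared length of the edge ab. *)
Definition edge_deriv (K : comNzRingType) n d (x u : 'M[K]_(n, d)) (a b : 'I_n) : K :=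
  \sum_c (x a c - x b c) * (u a c - u b c).

Definition coord_mx n d : 'M[mpoly (n * d) rat]_(n, d) :=
  \matrix_(v, c) mpolyX rat (mnm1 (mxvec_index v c)).

(* (#|s|.-1)!^2 times the squared volume of s; junk value 0 on the empty set. *)
Definition sq_vol_poly n d (s : {set 'I_n}) : mpoly (n * d) rat :=
  if enum s is v :: t then \det (gram_mx (coord_mx n d) v t) else 0.

Section Rigidity.
Variable R : realType.
Variables n d : nat.
Implicit Types (p u : 'M[R]_(n, d)) (s : {set 'I_n}).

Lemma eval_coord_mx p : map_mx (rat_eval (mxvec p ord0)) (coord_mx n d) = p.
Proof.
apply/matrixP => v c; rewrite !mxE /rat_eval /= map_mpolyX mevalXU.
by rewrite mxvecE.
Qed.

Lemma edge_mx_gram p v t :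
  \det (edge_mx [seq row w p | w <- v :: t] *m (edge_mx [seq row w p | w <- v :: t])^T)
  = \det (gram_mx p v t).
Proof.
rewrite /edge_mx /=.
(* The two matrix sizes are only provably equal, so one is generalised before the equality is
   eliminated. *)
have: size [seq row w p | w <- t] = size t by rewrite size_map.
move: (size [seq row w p | w <- t]) => m em.
case: _ / (esym em); congr (\det _); apply/matrixP => i j; rewrite !mxE.
by apply: eq_bigr => c _; rewrite !mxE !(nth_map v) ?mxE.
Qed.

Lemma eval_sq_vol_poly p s k : #|s| = k.+1 ->
  simplex_volume [seq row v p | v in s] ^+ 2
  = (k`!%:R ^+ 2)^-1 * rat_eval (mxvec p ord0) (sq_vol_poly d s).
Proof.
rewrite cardE /image_mem /sq_vol_poly; case: (enum s) => [//|v t] [<-].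
rewrite /simplex_volume exprMn sqr_sqrtr ?det_gram_ge0 // edge_mx_gram.
rewrite -det_map_mx map_gram_mx eval_coord_mx mulrC exprVn; congr (_^-1 * _).
by rewrite /= size_map.
Qed.

Variables (X : complex n) (k : nat).

Definition rigidity_poly : 'M[mpoly (n * d) rat]_(#|face X k|, n * d) :=
  \matrix_(i, j) mderiv j (sq_vol_poly d (val (enum_val i))).

Lemma map_mpoly_mderiv N (q : mpoly N rat) i :
  map_mpoly (ratr : rat -> R) (mderiv i q) = mderiv i (map_mpoly (ratr : rat -> R) q).
Proof.
by apply/mpolyP => m; rewrite mcoeff_mderiv !mcoeff_map_mpoly mcoeff_mderiv raddfMn.
Qed.

(** Makes [generic_rank] applicable: squared volumes are rational polynomials in the coordinates,
    and [jacobian_meval] turns their analytic Jacobian into formal derivatives. *)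
Lemma rigidity_mxE p :
  rigidity_mx X k p
  = (k`!%:R ^+ 2)^-1 *: map_mx (rat_eval (mxvec p ord0)) rigidity_poly.
Proof.
pose c : R := (k`!%:R ^+ 2)^-1.
pose q (i : 'I_#|face X k|) := c *: map_mpoly (ratr : rat -> R) (sq_vol_poly d (val (enum_val i))).
rewrite /rigidity_mx (_ : sq_volume_map X k (d := d) = fun y => \row_i meval (y ord0) (q i)).
  rewrite jacobian_meval; apply/matrixP => i j; rewrite !mxE /q mderivZ mevalZ.
  by rewrite /rat_eval /= map_mpoly_mderiv.
apply/funext => y; apply/rowP => i; rewrite !mxE /q mevalZ.
rewrite (@eval_sq_vol_poly _ _ k) ?vec_mxK //.
by have := valP (enum_val i); rewrite inE => /andP[_ /eqP].
Qed.

Lemma rank_rigidity_mx p :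
  \rank (rigidity_mx X k p) = \rank (map_mx (rat_eval (mxvec p ord0)) rigidity_poly).
Proof.
by rewrite rigidity_mxE mxrank_scale_nz // invr_eq0 expf_eq0 /= pnatr_eq0 -lt0n fact_gt0.
Qed.

Definition dir_deriv p u (q : mpoly (n * d) rat) : R :=
  \sum_i mxvec u ord0 i * rat_eval (mxvec p ord0) (mderiv i q).

Lemma dir_deriv_additive p u : zmod_morphism (dir_deriv p u).
Proof.
move=> a b; rewrite /dir_deriv -sumrB; apply: eq_bigr => i _.
by rewrite mderivB rmorphB mulrBr.
Qed.

HB.instance Definition _ p u :=
  GRing.isZmodMorphism.Build _ _ (dir_deriv p u) (dir_deriv_additive p u).

Lemma dir_derivM p u a b : dir_deriv p u (a * b) =
  dir_deriv p u a * rat_eval (mxvec p ord0) b + rat_eval (mxvec p ord0) a * dir_deriv p u b.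
Proof.
rewrite /dir_deriv mulr_suml mulr_sumr -big_split /=; apply: eq_bigr => i _.
by rewrite mderivM rmorphD !rmorphM /=; ring.
Qed.

Lemma dir_deriv_coord p u v c : dir_deriv p u (coord_mx n d v c) = u v c.
Proof.
rewrite /dir_deriv mxE (bigD1 (mxvec_index v c)) //= big1 ?addr0.
  rewrite mderivX mnm1E eqxx scale1r.
  rewrite (_ : mnm_sub _ _ = mnm0) ?mpolyX0 ?rmorph1 ?mulr1 ?mxvecE //.
  by apply/mnmP => j; rewrite mnmBE subnn mnm0E.
by move=> j ij; rewrite mderivX mnm1E eq_sym (negPf ij) scale0r rmorph0 mulr0.
Qed.

(** Polarization: the inner product of [a - v] and [b - v] is half of
    [|a - v|^2 + |b - v|^2 - |a - b|^2]. Hence [u] acts on volumes through [edge_deriv] only. *)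
Lemma dir_deriv_gram p u v t i j : dir_deriv p u (gram_mx (coord_mx n d) v t i j) =
  edge_deriv p u (nth v t i) v + edge_deriv p u (nth v t j) v
    - edge_deriv p u (nth v t i) (nth v t j).
Proof.
rewrite mxE raddf_sum /edge_deriv -big_split -sumrB /=; apply: eq_bigr => c _.
have ev w : rat_eval (mxvec p ord0) (coord_mx n d w c) = p w c.
  by rewrite -[in RHS](eval_coord_mx p) [RHS]mxE.
rewrite dir_derivM !raddfB /= !dir_deriv_coord !ev; ring.
Qed.

Lemma dir_deriv_sq_vol p u s v t : enum s = v :: t ->
  dir_deriv p u (sq_vol_poly d s) = \sum_(i < size t) \sum_(j < size t)
    (edge_deriv p u (nth v t i) v + edge_deriv p u (nth v t j) v
      - edge_deriv p u (nth v t i) (nth v t j)) * cofactor (gram_mx p v t) i j.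
Proof.
rewrite /sq_vol_poly => ->; rewrite (derivation_det (@dir_derivM p u)).
rewrite map_gram_mx eval_coord_mx.
by apply: eq_bigr => i _; apply: eq_bigr => j _; rewrite /= dir_deriv_gram.
Qed.

Lemma mul_rigidity_poly p u i :
  (mxvec u *m (map_mx (rat_eval (mxvec p ord0)) rigidity_poly)^T) ord0 i
  = dir_deriv p u (sq_vol_poly d (val (enum_val i))).
Proof. by rewrite mxE; apply: eq_bigr => j _; rewrite !mxE. Qed.

End Rigidity.

(** * Infinitesimal isometries *)

Section Motions.
Variable R : numFieldType.
Variables n d : nat.
Implicit Types (p u : 'M[R]_(n, d)) (K : 'M[R]_(1 + d)).

Lemma skew_diag0 m (H : 'M[R]_m) i : H^T = - H -> H i i = 0.
Proof.
move=> /matrixP/(_ i i); rewrite !mxE => /eqP.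
by rewrite -subr_eq0 opprK -mulr2n mulrn_eq0 /= => /eqP.
Qed.

(** Homogeneous coordinates: [1 + d] of these rows form an invertible matrix exactly when the points
    affinely span. *)
Definition affine_mx p : 'M[R]_(n, 1 + d) := row_mx (const_mx 1) p.

Lemma row_rsubmx m (A : 'M[R]_(m, 1 + d)) a : row a (rsubmx A) = rsubmx (row a A).
Proof. by apply/rowP => j; rewrite !mxE. Qed.

(* With K = [[0, t], [-t^T, A]] skew-symmetric, this is the motion p_v |-> t + p_v A. *)
Definition motion p K : 'M[R]_(n, d) := rsubmx (affine_mx p *m K).

Lemma motion_is_linear p : linear (motion p).
Proof. by move=> a K L; rewrite /motion mulmxDr -scalemxAr linearP. Qed.

HB.instance Definition _ p :=
  GRing.isLinear.Build R _ _ _ (motion p) (motion_is_linear p).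

Lemma edge_derivE p u a b :
  edge_deriv p u a b = ((row a u - row b u) *m (row a p - row b p)^T) ord0 ord0.
Proof. by rewrite mxE; apply: eq_bigr => c _; rewrite !mxE mulrC. Qed.

Lemma edge_derivB p u u' a b :
  edge_deriv p (u - u') a b = edge_deriv p u a b - edge_deriv p u' a b.
Proof. by rewrite /edge_deriv -sumrB; apply: eq_bigr => c _; rewrite !mxE; ring. Qed.

(** The difference [q] of two rows of homogeneous coordinates starts with 0, so the edge derivative
    equals [q K q^T], which vanishes for skew-symmetric [K]. *)
Lemma edge_deriv_motion p K a b : K^T = - K -> edge_deriv p (motion p K) a b = 0.
Proof.
move=> skK; rewrite edge_derivE.
set q := row a (affine_mx p) - row b (affine_mx p).
have qE : q = row_mx 0 (row a p - row b p).
  by rewrite /q /affine_mx !row_row_mx opp_row_mx add_row_mx !row_const subrr.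
have -> : row a (motion p K) - row b (motion p K) = rsubmx (q *m K).
  by rewrite /q mulmxBl linearB /= /motion !row_rsubmx !row_mul.
have -> : rsubmx (q *m K) *m (row a p - row b p)^T = q *m K *m q^T.
  have qT : q^T = col_mx 0 (row a p - row b p)^T by rewrite qE tr_row_mx trmx0.
  by rewrite qT -[q *m K in RHS]hsubmxK mul_row_col mulmx0 add0r.
by rewrite skew_diag0 // !trmx_mul trmxK skK mulmxA mulmxN mulNmx.
Qed.

(** A motion [K] is first fitted to [u] on the spanning simplex; the remainder [w = u - motion p K]
    vanishes there, and at any other vertex it is orthogonal to edges that span the whole space. *)
Lemma motion_complete p u (f : 'I_(1 + d) -> 'I_n) :
  rowsub f (affine_mx p) \in unitmx ->
  (forall v i, edge_deriv p u v (f i) = 0) ->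
  exists2 K, K^T = - K & u = motion p K.
Proof.
set P := rowsub f _ => uP eu.
have PE : P = row_mx (const_mx 1) (rowsub f p).
  apply/row_matrixP => i; rewrite row_rowsub /affine_mx !row_row_mx row_rowsub.
  by rewrite !row_const.
pose W := rowsub f u *m (rowsub f p)^T.
(* The unknown first column of [P K] is chosen to give [H = P K P^T] a zero diagonal; the edge
   conditions then make [H] skew-symmetric. *)
pose U := row_mx (\col_i - W i i) (rowsub f u).
pose H := U *m P^T.
have HE i j : H i j = W i j - W i i.
  rewrite /H /U PE tr_row_mx mul_row_col [LHS]mxE addrC; congr (_ + _).
  by rewrite mxE big_ord1 !mxE mulr1.
have skH : H^T = - H.
  apply/matrixP => i j; rewrite mxE [RHS]mxE !HE.
  have := eu (f i) j; have -> : edge_deriv p u (f i) (f j) = (W i i - W i j) - (W j i - W j j).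
    rewrite !mxE -!sumrB; apply: eq_bigr => c _; rewrite !mxE; ring.
  by move=> e; rewrite -[LHS]addr0 -e; ring.
pose K := invmx P *m U.
have PK : P *m K = U by rewrite mulmxA mulmxV // mul1mx.
have KE : K = invmx P *m H *m (invmx P)^T.
  by rewrite /H mulmxA -mulmxA -trmx_mul mulVmx // trmx1 mulmx1.
have skK : K^T = - K.
  by rewrite KE trmx_mul (trmx_mul _ H) trmxK skH mulmxA mulmxN mulNmx.
exists K => //; apply/eqP; rewrite -subr_eq0; apply/eqP.
set w := u - motion p K.
have wf i : row (f i) w = 0.
  rewrite /w linearB /= /motion row_rsubmx row_mul -[row _ (affine_mx p)]row_rowsub -row_mul PK.
  by rewrite /U row_row_mx row_mxKr row_rowsub subrr.
apply/row_matrixP => v; rewrite row0.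
(* Orthogonality of [w_v] to each [p_v - p_(f i)] says that the column [(-s, w_v)] is in the kernel
   of [P]. *)
pose s := (row v p *m (row v w)^T).
have : P *m col_mx (- s) (row v w)^T = 0.
  apply/row_matrixP => i; rewrite row0 row_mul row_rowsub /affine_mx row_row_mx.
  rewrite mul_row_col row_const.
  have : edge_deriv p w v (f i) = 0 by rewrite /w edge_derivB eu edge_deriv_motion // subr0.
  rewrite edge_derivE wf subr0 => e.
  have /(congr1 trmx) : row v w *m (row v p - row (f i) p)^T = 0.
    by apply/matrixP => a b; rewrite !ord1 e mxE.
  rewrite trmx_mul trmxK trmx0 mulmxBl => /eqP; rewrite subr_eq0 -/s => /eqP <-.
  rewrite (_ : const_mx 1 = 1%:M); last by apply/matrixP => a b; rewrite !ord1 !mxE.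
  by rewrite mulmxN mul1mx addNr.
move/(congr1 (mulmx (invmx P))); rewrite mulKmx // mulmx0 -col_mx0.
by case/eq_col_mx => _ /(congr1 trmx); rewrite trmxK trmx0.
Qed.

(** Indexes a basis of the skew-symmetric matrices, and so of the infinitesimal isometries. *)
Definition ord_pair : finType := {ab : 'I_(1 + d) * 'I_(1 + d) | (ab.1 < ab.2)%N}.

Lemma card_ord_pair : #|ord_pair| = 'C(d.+1, 2).
Proof.
rewrite card_sig -sum1_card.
rewrite -(pair_big_dep predT (fun a b : 'I_(1 + d) => a < b)%N (fun _ _ => 1%N)) /=.
rewrite (exchange_big_dep predT) //= -bin2_sum big_mkord; apply: eq_bigr => b _.
have wi : injective (widen_ord (ltnW (ltn_ord b))) by move=> i j [ij]; apply: val_inj.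
rewrite sum1_card -[RHS]card_ord -(card_image wi).
apply: eq_card => a; apply/idP/imageP => [ab|[c _ ->]]; last exact: ltn_ord c.
by exists (Ordinal (ab : (a < b)%N)) => //; apply: val_inj.
Qed.

Definition skew_delta (ab : 'I_(1 + d) * 'I_(1 + d)) : 'M[R]_(1 + d) :=
  delta_mx ab.1 ab.2 - delta_mx ab.2 ab.1.

Definition skew_comb (c : 'I_#|ord_pair| -> R) : 'M[R]_(1 + d) :=
  \sum_i c i *: skew_delta (val (enum_val i)).

Lemma skew_comb_skew c : (skew_comb c)^T = - skew_comb c.
Proof.
rewrite /skew_comb linear_sum -sumrN; apply: eq_bigr => i _.
by rewrite linearZ linearB /= !trmx_delta -scalerN opprB.
Qed.

Lemma skew_combE c (t : ord_pair) :
  skew_comb c (val t).1 (val t).2 = c (enum_rank t).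
Proof.
rewrite /skew_comb summxE (bigD1 (enum_rank t)) //= big1 => [|i it].
  rewrite addr0 !mxE enum_rankK !eqxx /= (_ : _ && _ = false) ?subr0 ?mulr1 //.
  by have := valP t; case: eqP => //= ->; rewrite ltnn.
have tN : val (enum_val i) != val t.
  by apply: contra it => /eqP/val_inj <-; rewrite enum_valK.
rewrite !mxE; move: tN; case: (enum_val i) (t) => [[a' b'] /= ab'] [[a b] /= ab].
rewrite xpair_eqE eq_sym [b' == b]eq_sym => /negPf ->.
rewrite (_ : _ && _ = false) ?subr0 ?mulr0 //.
by apply/negP => /andP[/eqP ? /eqP ?]; subst; move: (ltn_trans ab ab'); rewrite ltnn.
Qed.

Lemma skewE K : K^T = - K ->
  K = skew_comb (fun i => K (val (enum_val i)).1 (val (enum_val i)).2).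
Proof.
move=> skK; set L := skew_comb _.
have skL : L^T = - L by exact: skew_comb_skew.
have lt (a b : 'I_(1 + d)) : (a < b)%N -> K a b = L a b.
  by move=> ab; rewrite (skew_combE _ (exist _ (a, b) ab)) enum_rankK.
have sk (H : 'M[R]_(1 + d)) a b : H^T = - H -> H b a = - H a b.
  by move=> /matrixP/(_ a b); rewrite !mxE.
apply/matrixP => a b; case: (ltngtP a b) => [/lt //|ba|/val_inj ->].
  by rewrite (sk K b a) // (sk L b a) // lt.
by rewrite !skew_diag0.
Qed.

Definition motion_mx p : 'M[R]_(#|ord_pair|, n * d) :=
  \matrix_(i < #|ord_pair|) mxvec (motion p (skew_delta (val (enum_val i)))).

Lemma mul_motion_mx p (c : 'rV[R]_#|ord_pair|) :
  c *m motion_mx p = mxvec (motion p (skew_comb (c ord0))).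
Proof.
rewrite mulmx_sum_row /skew_comb !linear_sum; apply: eq_bigr => i _.
by rewrite rowK !linearZ.
Qed.

Lemma motion_sub p K : K^T = - K -> (mxvec (motion p K) <= motion_mx p)%MS.
Proof.
move=> /skewE ->; apply/submxP.
exists (\row_i K (val (enum_val i)).1 (val (enum_val i)).2); rewrite mul_motion_mx.
congr (mxvec (motion p _)); apply: eq_bigr => i _; by rewrite mxE.
Qed.

(** If [K] gives the zero motion, then [P K] has only its first column [z], and [z] is the diagonal
    of the skew-symmetric [P K P^T]. So [z = 0] and [K = 0]. *)
Lemma motion_mx_free p (f : 'I_(1 + d) -> 'I_n) :
  rowsub f (affine_mx p) \in unitmx -> row_free (motion_mx p).
Proof.
set P := rowsub f _ => uP.
rewrite -kermx_eq0; apply/eqP/row_matrixP => l; rewrite row0.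
set c := row l _.
have /sub_kermxP : (c <= kermx (motion_mx p))%MS by exact: row_sub.
rewrite mul_motion_mx; set K := skew_comb _ => /eqP; rewrite mxvec_eq0 => /eqP K0.
have skK : K^T = - K by exact: skew_comb_skew.
pose z := lsubmx (P *m K).
have PK : P *m K = row_mx z 0.
  rewrite -[LHS]hsubmxK -/z; congr row_mx; apply/row_matrixP => i.
  by rewrite row_rsubmx row_mul row_rowsub -row_mul -row_rsubmx -/(motion p K) K0 !row0.
have PKP i j : (P *m K *m P^T) i j = z i ord0.
  rewrite PK (_ : P = row_mx (const_mx 1) (rowsub f p)); last first.
    apply/row_matrixP => a; rewrite row_rowsub /affine_mx !row_row_mx row_rowsub.
    by rewrite !row_const.
  by rewrite tr_row_mx mul_row_col mul0mx addr0 mxE big_ord1 !mxE mulr1.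
have sk : (P *m K *m P^T)^T = - (P *m K *m P^T).
  by rewrite !trmx_mul trmxK skK mulmxA mulmxN mulNmx.
have z0 : z = 0 by apply/colP => i; rewrite -(PKP i i) skew_diag0 // mxE.
have K00 : K = 0.
  by rewrite -(mulKmx uP K) PK z0 row_mx0 mulmx0.
apply/rowP => i; rewrite [RHS]mxE -[i]enum_valK -skew_combE -/K K00.
by rewrite mxE.
Qed.

End Motions.

(** * Linear systems indexed by faces *)

Section PairSums.
Variables (R : realFieldType) (I : finType) (L : I -> I -> R).
Hypothesis Lsym : forall i j, L i j = L j i.
Hypothesis Ldiag : forall i, L i i = 0.

(** Over ordered pairs: for symmetric [L], each edge counts twice. *)
Definition pair_sum (A : {set I}) : R := \sum_(i in A) \sum_(j in A) L i j.

Lemma pair_sumU1 (A : {set I}) a : a \notin A ->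
  pair_sum (a |: A) = pair_sum A + 2 * \sum_(j in A) L a j.
Proof.
move=> aA; rewrite /pair_sum big_setU1 //= big_setU1 //= Ldiag add0r.
have -> : \sum_(i in A) \sum_(j in a |: A) L i j
    = \sum_(j in A) L a j + \sum_(i in A) \sum_(j in A) L i j.
  by rewrite -big_split /=; apply: eq_bigr => i iA; rewrite big_setU1 //= Lsym.
ring.
Qed.

Lemma subset_card (B : {set I}) m : (m <= #|B|)%N ->
  exists2 A : {set I}, A \subset B & #|A| = m.
Proof.
move=> mB; exists [set x in take m (enum B)].
  by apply/subsetP => x; rewrite inE => /mem_take; rewrite mem_enum.
rewrite cardsE; have /card_uniqP -> : uniq (take m (enum B)) by rewrite take_uniq ?enum_uniq.
by rewrite size_takel // -cardE.
Qed.

(* Injectivity of the inclusion matrix of pairs in m-sets: exchanging two elements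
   of A against two others isolates the alternating sum over a 4-cycle. *)
Lemma pair_sum_eq0 m : (2 <= m)%N -> (m + 2 <= #|I|)%N ->
  (forall A : {set I}, #|A| = m -> pair_sum A = 0) -> forall i j, L i j = 0.
Proof.
move=> m2 mI F0.
have swap (A : {set I}) a b : #|A| = m.-1 -> a \notin A -> b \notin A ->
    \sum_(j in A) L a j = \sum_(j in A) L b j.
  move=> cA aA bA.
  have Fa : pair_sum (a |: A) = 0 by apply: F0; rewrite cardsU1 aA cA; lia.
  have Fb : pair_sum (b |: A) = 0 by apply: F0; rewrite cardsU1 bA cA; lia.
  by move: Fa Fb; rewrite !pair_sumU1 // => Fa Fb; lra.
have four a b c e : c \notin [set a; b] -> e \notin [set a; b] ->
    L a c - L b c = L a e - L b e.
  have [-> //|ce] := eqVneq c e; move=> cab eab.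
  (* The common part of the exchanged sets must avoid the whole 4-cycle; [m + 2 <= #|I|] leaves
     enough room. *)
  have [W sW cW] : exists2 W : {set I}, W \subset ~: [set a; b; c; e] & #|W| = m.-2.
    apply: subset_card; have := cardsC [set a; b; c; e].
    have : (#|[set a; b; c; e]| <= 4)%N.
      do 2!rewrite (leq_trans (leq_card_setU _ _)) // cards1 addn1 ltnS.
      by rewrite cards2; case: (_ != _).
    lia.
  have nW x : x \in [set a; b; c; e] -> x \notin W.
    by move=> xs; apply: contraL xs => /(subsetP sW); rewrite inE.
  have [aW bW cW' eW] : [/\ a \notin W, b \notin W, c \notin W & e \notin W].
    by split; apply: nW; rewrite !inE eqxx ?orbT.
  move: cab eab; rewrite !inE !negb_or => /andP[ca cb] /andP[ea eb].
  have := swap (c |: W) a b; have := swap (e |: W) a b.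
  rewrite !cardsU1 cW' eW cW !inE !negb_or ![a == _]eq_sym ![b == _]eq_sym ca cb ea eb aW bW.
  rewrite !big_setU1 //= => h1 h2.
  have {}h1 := h1 ltac:(lia) isT isT; have {}h2 := h2 ltac:(lia) isT isT; lra.
(* By [four], all terms [L a j - L b j] with [j] in [A] are equal; they sum to 0 by [swap], and [A]
   is nonempty. *)
have col a b c : c \notin [set a; b] -> L a c = L b c.
  move=> cab.
  have [A sA cA] : exists2 A : {set I}, A \subset ~: [set a; b] & #|A| = m.-1.
    apply: subset_card; have := cardsC [set a; b].
    have : (#|[set a; b]| <= 2)%N by rewrite cards2; case: (_ != _).
    lia.
  have nA x : x \in [set a; b] -> x \notin A.
    by move=> xs; apply: contraL xs => /(subsetP sA); rewrite inE.
  have := swap A a b cA (nA a _) (nA b _); rewrite !inE !eqxx orbT => /(_ isT isT)/eqP.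
  rewrite -subr_eq0 -sumrB (eq_bigr (fun=> L a c - L b c)); last first.
    by move=> e /(subsetP sA); rewrite inE => eab; exact: four.
  rewrite sumr_const cA mulrn_eq0 => /orP[/eqP|]; first lia.
  by rewrite subr_eq0 => /eqP.
have rowc i j j' : i != j -> i != j' -> L i j = L i j'.
  by move=> ij ij'; rewrite Lsym (Lsym i j'); apply: col; rewrite !inE negb_or ij.
move=> i j; have [->|ij] := eqVneq i j; first exact: Ldiag.
have const i' j' : i' != j' -> L i' j' = L i j.
  move=> ij'; have [e|ne] := eqVneq i' j.
    by rewrite e (Lsym i j); apply: rowc; rewrite -?e // e eq_sym.
  rewrite (rowc i' j' j) // (Lsym i' j) (Lsym i j).
  by apply: rowc; rewrite eq_sym.
have [A _ cA] : exists2 A : {set I}, A \subset setT & #|A| = m.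
  by apply: subset_card; rewrite cardsT; lia.
have := F0 A cA; rewrite /pair_sum (eq_bigr (fun=> L i j *+ m.-1)) => [|i' iA].
  rewrite sumr_const cA -mulrnA => /eqP; rewrite mulrn_eq0 => /orP[/eqP|/eqP //]; nia.
rewrite (big_setD1 i') //= Ldiag add0r (eq_bigr (fun=> L i j)).
  by rewrite sumr_const; congr (_ *+ _); have := cardsD1 i' A; rewrite iA cA; lia.
by move=> j'; rewrite !inE => /andP[ji _]; apply: const; rewrite eq_sym.
Qed.

(** The facet conditions kill the row sums [X a]; the cone conditions then express [L] through [y],
    and the row sums of that expression determine [y]. *)
Lemma pair_sum_cone_eq0 (y : I -> R) d : (2 <= d)%N -> #|I| = d.+1 ->
  (forall A : {set I}, #|A| = d -> pair_sum A = 0) ->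
  (forall A : {set I}, #|A| = d.-1 ->
     2 * d.+1%:R * \sum_(i in A) y i = pair_sum A) ->
  (forall i j, L i j = 0) /\ (forall i, y i = 0).
Proof.
move=> d2 cI F0 Fy.
pose X a := \sum_j L a j; pose Y := \sum_j y j.
have cC (a : I) : #|~: [set a]| = d by rewrite cardsC1 cI.
have sumC a (F : I -> R) : \sum_(j in ~: [set a]) F j = \sum_j F j - F a.
  rewrite [in RHS](bigD1 a) //= addrC addrK; apply: eq_bigl => j; by rewrite !inE.
have NR : d.+1%:R != 0 :> R by rewrite pnatr_eq0.
(* The facet opposite [b] shows that the total is [2 * X b]. Summing over the [d + 1] values of [b]
   gives [d + 1] times the total equal to twice the total. *)
have X0 a : X a = 0.
  have XX b : pair_sum setT = 2 * X b.
    have -> : setT = b |: ~: [set b] by rewrite setUCr.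
    by rewrite pair_sumU1 ?F0 ?add0r ?sumC ?Ldiag ?subr0 // !inE eqxx.
  have : \sum_(b : I) pair_sum setT = 2 * pair_sum setT.
    rewrite (eq_bigr (fun b => 2 * X b)) // -mulr_sumr; congr (2 * _).
    rewrite /pair_sum; apply: eq_big => [i|i _]; first by rewrite inE.
    by apply: eq_bigl => j; rewrite inE.
  have dE : d.+1%:R = d.-1%:R + 2 :> R by rewrite -natrD; congr _%:R; lia.
  rewrite sumr_const cI -[pair_sum _ *+ _]mulr_natl dE mulrDl -[RHS]add0r => /addIr/eqP.
  rewrite mulf_eq0 pnatr_eq0 (_ : (_ == 0)%N = false) /=; last by lia.
  by rewrite (XX a) mulf_eq0 pnatr_eq0 => /eqP.
(* Let [D] be the set without [a] and [b]. Adding [b] to [D] gives a facet, whence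
   [pair_sum D = 2 * L a b] as [X b = 0]; the cone condition on [D] gives its other value. *)
have Lab a b : a != b -> L a b = d.+1%:R * (Y - y a - y b).
  move=> ab.
  have bC : b \in ~: [set a] by rewrite !inE eq_sym.
  have := cardsD1 b (~: [set a]); rewrite bC cC => c.
  have := Fy (~: [set a] :\ b) ltac:(lia).
  have sD (F : I -> R) : \sum_(j in ~: [set a] :\ b) F j = \sum_j F j - F a - F b.
    by rewrite -sumC [in RHS](big_setD1 b) //= addrC addrK.
  rewrite sD -/Y => e2; have := F0 _ (cC a).
  rewrite -(setD1K bC) pair_sumU1 ?setD11 // !sD -/(X b) X0 Ldiag (Lsym b a) => e1.
  by lra.
have ya a : y a = Y.
  have : \sum_(b in ~: [set a]) L a b = 0 by rewrite sumC Ldiag subr0 -/(X a) X0.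
  rewrite (eq_bigr (fun b => d.+1%:R * (Y - y a - y b))) => [|b]; last first.
    by rewrite !inE eq_sym => /Lab.
  rewrite -mulr_sumr sumC sumrB sumr_const cI -/Y => /eqP.
  rewrite mulf_eq0 (negPf NR) /= -mulr_natl => /eqP e.
  have {}e : (Y - y a) * (d%:R - 1) = 0 by rewrite -e -natr1; ring.
  move/eqP: e; rewrite mulf_eq0 subr_eq0 => /orP[/eqP-> //|].
  by rewrite subr_eq0 (eqr_nat _ _ 1) => /eqP; lia.
have Y0 : Y = 0.
  have : Y = d.+1%:R * Y by rewrite {1}/Y (eq_bigr (fun=> Y)) // sumr_const cI mulr_natl.
  rewrite -natr1 mulrDl mul1r => /eqP; rewrite -subr_eq0 opprD addrCA subrr addr0 oppr_eq0 mulf_eq0.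
  by rewrite pnatr_eq0 => /orP[/eqP|/eqP //]; lia.
split=> [a b|a]; last by rewrite ya.
have [->|ab] := eqVneq a b; first exact: Ldiag.
by rewrite Lab // !ya Y0 !subr0 mulr0.
Qed.

End PairSums.

(** * Identity plus constant matrices, and the regular simplex *)

Section ConstantPerturbation.
Variable R : fieldType.

(** The all-ones matrix [J] satisfies [J^2 = k J]. *)
Lemma mulmx_id_const k (a x : R) : a + x + k%:R * (a * x) = 0 ->
  (1%:M + const_mx a) *m (1%:M + const_mx x) = 1%:M :> 'M[R]_k.
Proof.
move=> ax; rewrite mulmxDr mulmx1 mulmxDl mul1mx.
have -> : (const_mx a : 'M[R]_k) *m const_mx x = const_mx (k%:R * (a * x)) :> 'M[R]_k.
  by apply/matrixP => i j; rewrite !mxE; under eq_bigr do rewrite !mxE;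
    rewrite sumr_const card_ord mulr_natl.
apply/matrixP => i j; rewrite !mxE -[RHS]addr0 -ax; ring.
Qed.

Lemma cofactor_inv k (G H : 'M[R]_k) i j : G *m H = 1%:M -> cofactor G i j = \det G * H j i.
Proof.
move=> GH; have : \adj G *m (G *m H) = \det G *: H by rewrite mulmxA mul_adj_mx mul_scalar_mx.
by rewrite GH mulmx1 => /matrixP/(_ j i); rewrite !mxE.
Qed.

(* Jacobi's formula at G = 1 + aJ, whose inverse is 1 + xJ, where the derivative of
   the Gram matrix has been written with edge lengths: l for the edges at the base
   vertex, e for the other ones. *)
Lemma det_id_const_deriv k (a x : R) (l : 'I_k -> R) (e : 'I_k -> 'I_k -> R) :
  a + x + k%:R * (a * x) = 0 -> (forall i, e i i = 0) ->
  \sum_i \sum_j (l i + l j - e i j) * cofactor (1%:M + const_mx a) i j = 0 ->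
  2 * (1 + x * k%:R) * \sum_i l i = x * \sum_i \sum_j e i j.
Proof.
move=> /mulmx_id_const ax e0.
have d0 : \det (1%:M + const_mx a : 'M[R]_k) != 0.
  have /(congr1 determinant) := ax; rewrite det_mulmx det1; apply: contra_eq_neq => ->.
  by rewrite mul0r eq_sym oner_eq0.
have -> : \sum_i \sum_j (l i + l j - e i j) * cofactor (1%:M + const_mx a) i j =
   \det (1%:M + const_mx a : 'M[R]_k) * (2 * (1 + x * k%:R) * \sum_i l i - x * \sum_i \sum_j e i j).
  transitivity (\det (1%:M + const_mx a : 'M[R]_k) *
     \sum_i (2 * l i + x * (k%:R * l i + \sum_j l j - \sum_j e i j))); last first.
    congr (_ * _); rewrite big_split /= -mulr_sumr -mulr_sumr sumrB big_split /= -mulr_sumr.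
    rewrite sumr_const card_ord -mulr_natl; ring.
  rewrite mulr_sumr; apply: eq_bigr => i _.
  transitivity (\det (1%:M + const_mx a : 'M[R]_k) *
     (\sum_j ((j == i)%:R * (l i + l j - e i j) + x * (l i + l j - e i j)))).
    rewrite mulr_sumr; apply: eq_bigr => j _.
    by rewrite (cofactor_inv _ _ ax) !mxE; ring.
  congr (_ * _); rewrite big_split /=; congr (_ + _).
    rewrite (bigD1 i) //= eqxx e0 big1 => [|j /negPf ->]; last by rewrite mul0r.
    by rewrite /=; ring.
  by rewrite -mulr_sumr sumrB big_split /= sumr_const card_ord mulr_natl.
by move/eqP; rewrite mulf_eq0 (negPf d0) /= subr_eq0 => /eqP.
Qed.

End ConstantPerturbation.

(* Centred at 0 and of edge length sqrt 2: the vertices are -w(1, ..., 1) and the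
   e_i + a(1, ..., 1), with w and a solving the equations for the inner products. *)
Lemma regular_simplex (R : rcfType) d : (0 < d)%N ->
  exists S : 'M[R]_(1 + d, d), forall i j,
    \sum_c S i c * S j c = (i == j)%:R - d.+1%:R^-1.
Proof.
(* The value of [w] makes [d w^2 = 1 - 1 / (d + 1)]; that of [a] makes the coordinate sum
   [- w + 1 + d a] over the vertices vanish. *)
move=> d0; pose w : R := Num.sqrt d.+1%:R^-1; pose a := (w - 1) / d%:R.
have w2 : w * w = d.+1%:R^-1 by rewrite -expr2 sqr_sqrtr // invr_ge0 ler0n.
have dR : d%:R != 0 :> R by rewrite pnatr_eq0 -lt0n.
have da : d%:R * a = w - 1 by rewrite /a mulrC divfK.
have dw : d%:R * (w * w) = 1 - d.+1%:R^-1.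
  by rewrite w2 -natr1; field; rewrite natr1 pnatr_eq0.
have aw : 2 * a + d%:R * (a * a) = - (w * w).
  have -> : 2 * a + d%:R * (a * a) = (w * w - 1) / d%:R by rewrite mulrA da /a; field.
  by rewrite w2 -natr1; field; rewrite natr1 pnatr_eq0 dR.
have sumc (b : R) : \sum_(c < d) b = d%:R * b by rewrite sumr_const card_ord mulr_natl.
have sumd (i : 'I_d) (F : 'I_d -> R) : \sum_c (i == c)%:R * F c = F i.
  rewrite (bigD1 i) //= eqxx mul1r big1 ?addr0 // => c.
  by rewrite eq_sym => /negPf->; rewrite mul0r.
exists (col_mx (const_mx (- w)) (1%:M + const_mx a)) => i j.
have cross (i' : 'I_d) : \sum_(c < d) - w * ((i' == c)%:R + a) = - d.+1%:R^-1.
  rewrite -mulr_sumr big_split /= sumc da -[X in X + _](eq_bigr _ (fun c _ => mulr1 _)) sumd.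
  by rewrite -w2; ring.
rewrite -[i]fintype.splitK -[j]fintype.splitK.
case: (fintype.split i) => i'; case: (fintype.split j) => j' /=.
- under eq_bigr do rewrite !col_mxEu !mxE.
  by rewrite sumc !ord1 eqxx mulrNN dw.
- under eq_bigr do rewrite col_mxEu col_mxEd !mxE.
  by rewrite cross eq_lrshift sub0r.
- under eq_bigr do rewrite col_mxEu col_mxEd !mxE mulrC.
  by rewrite cross eq_rlshift sub0r.
under eq_bigr do rewrite !col_mxEd !mxE mulrDl mulrDr.
rewrite !big_split /= !sumd eq_rshift -mulr_sumr big_split /= sumc.
rewrite -[X in _ + _ * (X + _)](eq_bigr _ (fun c _ => mulr1 _)) sumd.
by rewrite [j' == i']eq_sym -w2 -[w * w]opprK -aw; ring.
Qed.

(** * The special position *)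

Lemma edge_derivC (K : comNzRingType) n d (p u : 'M[K]_(n, d)) a b :
  edge_deriv p u a b = edge_deriv p u b a.
Proof. by apply: eq_bigr => c _; ring. Qed.

Lemma edge_deriv_diag (K : comNzRingType) n d (p u : 'M[K]_(n, d)) a :
  edge_deriv p u a a = 0.
Proof. by rewrite /edge_deriv big1 // => c _; rewrite !subrr mul0r. Qed.

Section FaceRelations.
Variables (R : realType) (n d : nat) (p u : 'M[R]_(n, d)).
Local Notation e := (edge_deriv p u).

(** Common to both kinds of faces: seen from its base vertex, each has Gram matrix [1 + a J], and
    [x] encodes the inverse [1 + x J]. *)
Lemma face_relation (s : {set 'I_n}) v t (a x : R) : enum s = v :: t ->
  {in t &, forall w w', \sum_c (p w c - p v c) * (p w' c - p v c) = (w == w')%:R + a} ->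
  a + x + (size t)%:R * (a * x) = 0 ->
  dir_deriv p u (sq_vol_poly d s) = 0 ->
  2 * (1 + x * (size t)%:R) * \sum_(w <- t) e w v = x * \sum_(w <- t) \sum_(w' <- t) e w w'.
Proof.
move=> es pt ax; rewrite (dir_deriv_sq_vol p u es).
have ut : uniq t by have := enum_uniq s; rewrite es => /andP[].
have -> : gram_mx p v t = 1%:M + const_mx a.
  apply/matrixP => i j; rewrite !mxE pt ?mem_nth // nth_uniq //.
move/(det_id_const_deriv ax) => h.
rewrite !(big_nth v) !big_mkord; under [in RHS]eq_bigr do rewrite (big_nth v) big_mkord.
by apply: h => i; exact: edge_deriv_diag.
Qed.

Variable g : 'I_(1 + d) -> 'I_n.
Hypothesis ginj : injective g.
Hypothesis gp : forall i j, \sum_c p (g i) c * p (g j) c = (i == j)%:R - d.+1%:R^-1.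

Lemma pair_sum_image (A : {set 'I_(1 + d)}) :
  pair_sum (fun i j => e (g i) (g j)) A
  = \sum_(w <- enum (g @: A)) \sum_(w' <- enum (g @: A)) e w w'.
Proof.
rewrite big_enum big_imset /=; last exact: in2W.
by apply: eq_bigr => i _; rewrite big_enum big_imset //=; exact: in2W.
Qed.

Lemma simplex_face (A : {set 'I_(1 + d)}) :
  dir_deriv p u (sq_vol_poly d (g @: A)) = 0 -> pair_sum (fun i j => e (g i) (g j)) A = 0.
Proof.
move=> h; rewrite pair_sum_image.
have := erefl (enum (g @: A)); case: {1}(enum _) => [<-|v t]; first by rewrite big_nil.
move=> /esym es; rewrite es.
have ins w : w \in v :: t -> exists i, w = g i.
  by rewrite -es mem_enum => /imsetP[i _ ->]; exists i.
have : uniq (v :: t) by rewrite -es enum_uniq.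
move=> /= /andP[vt _].
have kR : (size t)%:R + 1 != 0 :> R by rewrite natr1 pnatr_eq0.
(* Edges of length sqrt 2 at angles of 60 degrees have Gram matrix [1 + J], with inverse
   [1 - J / (size t + 1)]. *)
have := face_relation es (a := 1) (x := - ((size t)%:R + 1)^-1).
move/(_ _ _ h) => {}h.
rewrite !big_cons edge_deriv_diag add0r.
under [X in _ + X]eq_bigr do rewrite big_cons.
rewrite big_split /= (eq_bigr _ (fun w _ => edge_derivC p u v w)).
have {h} : 2 * (1 - ((size t)%:R + 1)^-1 * (size t)%:R) * \sum_(w <- t) e w v =
    - ((size t)%:R + 1)^-1 * \sum_(w <- t) \sum_(w' <- t) e w w'.
  rewrite -h ?mulNr //; last by field.
  move=> w w' wt wt'.
  have [i wi] := ins w (mem_behead (s := v :: t) wt).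
  have [i' wi'] := ins w' (mem_behead (s := v :: t) wt').
  have [j vj] := ins v (mem_head _ _).
  have ij : i == j = false by apply: contraNF vt => /eqP ij; rewrite vj -ij -wi.
  have ij' : i' == j = false by apply: contraNF vt => /eqP ij'; rewrite vj -ij' -wi'.
  have -> : \sum_c (p w c - p v c) * (p w' c - p v c) =
    \sum_c p w c * p w' c - \sum_c p w c * p v c - \sum_c p v c * p w' c + \sum_c p v c * p v c.
    by rewrite -!sumrB -big_split; apply: eq_bigr => c _ /=; ring.
  rewrite wi wi' vj !gp (inj_eq ginj) eqxx ij [j == i']eq_sym ij' /=; ring.
move=> h.
have : ((size t)%:R + 1)^-1 * (\sum_(w <- t) e w v + (\sum_(w <- t) e w v
     + \sum_(w <- t) \sum_(w' <- t) e w w')) = 0.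
  rewrite -[RHS](subrr (- ((size t)%:R + 1)^-1 * \sum_(w <- t) \sum_(w' <- t) e w w')) -{1}h.
  by field.
by move/eqP; rewrite mulf_eq0 invr_eq0 (negPf kR) => /eqP.
Qed.

(* The hypothesis on the order makes v the base vertex of the Gram matrix. *)
Lemma cone_face v (A : {set 'I_(1 + d)}) : (forall c, p v c = 0) ->
  (forall i, (v < g i)%N) -> #|A| = d.-1 -> (0 < d)%N ->
  dir_deriv p u (sq_vol_poly d (v |: g @: A)) = 0 ->
  2 * d.+1%:R * \sum_(i in A) e (g i) v = pair_sum (fun i j => e (g i) (g j)) A.
Proof.
move=> pv vg cA d0 h; rewrite pair_sum_image.
have vA : v \notin g @: A by apply/imsetP => -[i _ vi]; have := vg i; rewrite -vi ltnn.
have [t es] : exists t, enum (v |: g @: A) = v :: t.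
  (* Sets of ordinals are enumerated in increasing order, so the least element [v] comes first. *)
  have so : sorted ltn (map val (enum (v |: g @: A))).
    rewrite (subseq_sorted ltn_trans (s2 := map val (enum 'I_n))) //; last first.
      by rewrite val_enum_ord iota_ltn_sorted.
    by rewrite map_subseq // enumT /enum_mem filter_subseq.
  have vin : v \in enum (v |: g @: A) by rewrite mem_enum !inE eqxx.
  have ge w : w \in enum (v |: g @: A) -> (v <= w)%N.
    by rewrite mem_enum !inE => /orP[/eqP->//|/imsetP[i _ ->]]; apply: ltnW.
  case: (enum _) so vin ge => //= w t so vin ge; exists t; congr (_ :: _).
  move: vin; rewrite inE => /orP[/eqP-> //|vt].
  have := order_path_min ltn_trans so => /allP/(_ _ (map_f val vt)) /=.
  by rewrite ltnNge ge ?mem_head.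
have pt : perm_eq t (enum (g @: A)).
  have ut := enum_uniq (v |: g @: A); rewrite es /= in ut; case/andP: ut => vt ut.
  apply: uniq_perm; rewrite ?enum_uniq // => w; rewrite mem_enum.
  have := mem_enum (v |: g @: A) w; rewrite es !inE.
  by case: eqP => [->|//]; rewrite (negPf vt) (negPf vA).
have st : size t = d.-1 by rewrite (perm_size pt) -cardE card_imset.
have dR : d%:R + 1 != 0 :> R by rewrite natr1 pnatr_eq0.
have dE : (size t)%:R = d%:R - 1 :> R by rewrite st -subn1 natrB.
(* From the centre, the Gram matrix is [1 - J / (d + 1)] of size [d - 1], whose inverse is
   [1 + J / 2]. *)
have : 2 * (1 + 2^-1 * (size t)%:R) * \sum_(w <- t) e w v =
    2^-1 * \sum_(w <- t) \sum_(w' <- t) e w w'.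
  apply: (face_relation es (a := - d.+1%:R^-1)) h.
    move=> w w'; rewrite !(perm_mem pt) !mem_enum => /imsetP[i _ ->] /imsetP[i' _ ->].
    by under eq_bigr do rewrite !pv !subr0; rewrite gp (inj_eq ginj).
  by rewrite dE -natr1; field.
rewrite dE (perm_big _ pt) /= big_enum big_imset /=; last exact: in2W.
rewrite [in RHS](perm_big _ pt) /=.
under [in RHS]eq_bigr do rewrite (perm_big _ pt) /=.
rewrite -(natr1 d) => h'. lra.
Qed.

(** The Gram matrix of the homogeneous coordinates is [1 + t J], with explicit inverse
    [1 - t / (d + 1) J]. *)
Lemma affine_simplex_unit : rowsub g (affine_mx p) \in unitmx.
Proof.
pose t : R := 1 - d.+1%:R^-1.
have PP : rowsub g (affine_mx p) *m (rowsub g (affine_mx p))^T = 1%:M + const_mx t.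
  have -> : rowsub g (affine_mx p) = row_mx (const_mx 1) (rowsub g p).
    apply/row_matrixP => a; rewrite row_rowsub /affine_mx !row_row_mx row_rowsub.
    by rewrite !row_const.
  rewrite tr_row_mx mul_row_col; apply/matrixP => i j; rewrite !mxE big_ord1 !mxE.
  under eq_bigr do rewrite !mxE; rewrite gp /t; ring.
have ax : t + - t / d.+1%:R + (1 + d)%:R * (t * (- t / d.+1%:R)) = 0.
  have : d%:R + 1 != 0 :> R by rewrite natr1 pnatr_eq0.
  by rewrite /t (_ : (1 + d)%:R = d.+1%:R) // -(natr1 d) => dR; field.
by have := mulmx_id_const ax; rewrite -PP -mulmxA => /mulmx1_unit[].
Qed.

End FaceRelations.

(** * Rank bounds for the complete complex *)

Section CompleteRank.
Variables (R : realType) (n d k : nat).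
Local Notation X := (complete_complex n k).
Implicit Types (p q : 'M[R]_(n, d)).

Definition eval_rigidity p : 'M[R]_(#|face X k|, n * d) :=
  map_mx (rat_eval (mxvec p ord0)) (rigidity_poly d X k).

Lemma mul_motion_eval p : motion_mx p *m (eval_rigidity p)^T = 0.
Proof.
apply/matrixP => i j; rewrite [RHS]mxE.
have -> : (motion_mx p *m (eval_rigidity p)^T) i j
   = (row i (motion_mx p) *m (eval_rigidity p)^T) ord0 j by rewrite -row_mul [RHS]mxE.
rewrite rowK mul_rigidity_poly.
set K := skew_delta R _.
have skK : K^T = - K by rewrite /K /skew_delta linearB /= !trmx_delta opprB.
case es: (enum (val (enum_val j))) => [|v t].
  by rewrite /sq_vol_poly es raddf0.
rewrite (dir_deriv_sq_vol _ _ es) big1 // => a _; rewrite big1 // => b _.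
by rewrite !edge_deriv_motion // subr0 addr0 mul0r.
Qed.

Lemma face_dir_deriv p (y : 'rV_(n * d)) (s : {set 'I_n}) :
  y *m (eval_rigidity p)^T = 0 -> #|s| = k.+1 ->
  dir_deriv p (vec_mx y) (sq_vol_poly d s) = 0.
Proof.
move=> y0 cs; have sX : s \in faces X k by rewrite !inE cs leqnn eqxx.
pose t : face X k := exist _ s sX.
have := mul_rigidity_poly p (vec_mx y) (enum_rank t).
by rewrite enum_rankK vec_mxK -/(eval_rigidity p) y0 mxE => /esym.
Qed.

(** By [motion_complete], the hypothesis leaves only infinitesimal isometries in the kernel, and
    their space has dimension at most ['C(d.+1, 2)]. *)
Lemma eval_rigidity_rank_ge p (g : 'I_(1 + d) -> 'I_n) :
  rowsub g (affine_mx p) \in unitmx ->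
  (forall u, (forall s : {set 'I_n}, #|s| = k.+1 -> dir_deriv p u (sq_vol_poly d s) = 0) ->
     forall v i, edge_deriv p u v (g i) = 0) ->
  (n * d - 'C(d.+1, 2) <= \rank (eval_rigidity p))%N.
Proof.
move=> gU ker.
have : (kermx (eval_rigidity p)^T <= motion_mx p)%MS.
  apply/rV_subP => y /sub_kermxP y0.
  have [K skK uE] := motion_complete gU (ker (vec_mx y) (fun s => face_dir_deriv y0)).
  by rewrite -[y]vec_mxK uE; exact: motion_sub.
move/mxrankS; rewrite mxrank_ker mxrank_tr => h.
have := rank_leq_row (motion_mx p); rewrite [X in (_ <= X)%N]card_ord_pair => hM.
rewrite leq_subLR (leq_trans _ (leq_add hM (leqnn _))) // -leq_subLR.
by rewrite leq_subLR addnC -leq_subLR.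
Qed.

Lemma eval_rigidity_rank_le p (g : 'I_(1 + d) -> 'I_n) :
  rowsub g (affine_mx p) \in unitmx ->
  (\rank (eval_rigidity p) <= n * d - 'C(d.+1, 2))%N.
Proof.
move=> gU; have := mulmx0_rank_max (mul_motion_eval p).
rewrite mxrank_tr (eqP (motion_mx_free gU)) card_ord_pair => h.
by rewrite leq_subRL // (leq_trans (leq_addr _ _) h).
Qed.

(** Homogeneous coordinates are rational polynomials too, so [generic_rank] carries full rank from
    [q] to [p]. *)
Lemma generic_affine_unit p q (g : 'I_(1 + d) -> 'I_n) : generic p ->
  rowsub g (affine_mx q) \in unitmx -> rowsub g (affine_mx p) \in unitmx.
Proof.
move=> gp; pose Q := rowsub g (row_mx (const_mx 1 : 'M_(n, 1)) (coord_mx n d)).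
have QE (r : 'M[R]_(n, d)) : rowsub g (affine_mx r) = map_mx (rat_eval (mxvec r ord0)) Q.
  by rewrite map_mxsub map_row_mx eval_coord_mx map_const_mx rmorph1.
rewrite -!row_free_unit /row_free !QE => /eqP qu.
rewrite eqn_leq rank_leq_row /= -{1}qu; exact: generic_rank.
Qed.

End CompleteRank.

(** Reduces each case to exhibiting a position [q]: the upper bound is proved at [p], the lower one
    at [q] and transferred. *)
Lemma complete_rank_eq (R : realType) (n d k : nat) (p q : 'M[R]_(n, d))
    (g : 'I_(1 + d) -> 'I_n) : generic p ->
  rowsub g (affine_mx q) \in unitmx ->
  (forall u, (forall s : {set 'I_n}, #|s| = k.+1 -> dir_deriv q u (sq_vol_poly d s) = 0) ->
     forall v i, edge_deriv q u v (g i) = 0) ->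
  matroid_rank (rigidity_matroid (complete_complex n k) k p)
    = (d * n - 'C(d + 1, 2))%N.
Proof.
move=> gp gU ker; rewrite linear_matroid_rank rank_rigidity_mx -/(eval_rigidity k p).
apply/eqP; rewrite eqn_leq addn1 (mulnC d n).
rewrite (eval_rigidity_rank_le k (generic_affine_unit gp gU)) /=.
apply: leq_trans (eval_rigidity_rank_ge gU ker) _; exact: generic_rank.
Qed.

Lemma complete_rank_hyperfaces (R : realType) m d (p : 'M[R]_(m.+1 + (1 + d), d)) : (2 <= d)%N -> generic p ->
  matroid_rank (rigidity_matroid (complete_complex _ d.-1) d.-1 p)
    = (d * (m.+1 + (1 + d)) - 'C(d + 1, 2))%N.
Proof.
move=> d2 gp; have [|S SS] := @regular_simplex R d; first by lia.
(* The vertices at the centre are numbered first, as [cone_face] requires. *)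
pose q : 'M[R]_(m.+1 + (1 + d), d) := col_mx 0 S.
pose g := @rshift m.+1 (1 + d).
have gq i j : \sum_c q (g i) c * q (g j) c = (i == j)%:R - d.+1%:R^-1.
  by under eq_bigr do rewrite !col_mxEd; exact: SS.
have gi : injective g by exact: rshift_inj.
apply: (complete_rank_eq gp (affine_simplex_unit gq)) => u ker.
set e := edge_deriv q u.
have center v : (forall i j, e (g i) (g j) = 0) /\ (forall i, e (g i) (lshift _ v) = 0).
  apply: (@pair_sum_cone_eq0 R _ (fun i j => e (g i) (g j)) _ _ _ d d2).
  - by move=> i j; exact: edge_derivC.
  - by move=> i; exact: edge_deriv_diag.
  - by rewrite card_ord.
  - by move=> A cA; apply: simplex_face => //; apply: ker; rewrite card_imset // cA; lia.
  move=> A cA; apply: cone_face => //.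
  - by move=> c; rewrite col_mxEu mxE.
  - by move=> i; rewrite /= ltn_addr.
  - by lia.
  apply: ker; rewrite cardsU1 card_imset // cA.
  rewrite (_ : _ \notin _) ?add1n //.
  by apply/imsetP => -[i _ /eqP]; rewrite eq_lrshift.
move=> v i; rewrite -[v]fintype.splitK; case: (fintype.split v) => j /=.
  by have [_ e0] := center j; rewrite [LHS]edge_derivC; exact: e0.
(* Edges of the simplex need just one central vertex, and there are [m.+1] of them. *)
by have [e0 _] := center ord0; exact: e0.
Qed.

Lemma complete_rank_small_faces (R : realType) m d k (p : 'M[R]_(m + (1 + d), d)) :
  (1 <= k)%N -> (k + 2 <= d)%N -> generic p ->
  matroid_rank (rigidity_matroid (complete_complex _ k) k p)
    = (d * (m + (1 + d)) - 'C(d + 1, 2))%N.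
Proof.
move=> k1 kd gp; have [|S SS] := @regular_simplex R d; first by lia.
pose q : 'M[R]_(m + (1 + d), d) := col_mx (\matrix_(i, j) S ord0 j) S.
pose g := @rshift m (1 + d).
have gq i j : \sum_c q (g i) c * q (g j) c = (i == j)%:R - d.+1%:R^-1.
  by under eq_bigr do rewrite !col_mxEd; exact: SS.
apply: (complete_rank_eq gp (affine_simplex_unit gq)) => u ker.
have simplex0 (h : 'I_(1 + d) -> 'I_(m + (1 + d))) : injective h ->
    (forall i c, q (h i) c = S i c) -> forall i j, edge_deriv q u (h i) (h j) = 0.
  move=> hi hq; apply: (@pair_sum_eq0 R _ (fun i j => edge_deriv q u (h i) (h j)) _ _ k.+1).
  - by move=> i j; exact: edge_derivC.
  - by move=> i; exact: edge_deriv_diag.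
  - by lia.
  - by rewrite card_ord; lia.
  move=> A cA; apply: simplex_face => //.
    by move=> i j; under eq_bigr do rewrite !hq; exact: SS.
  by apply: ker; rewrite card_imset // cA.
have gS i c : q (g i) c = S i c by rewrite col_mxEd.
have gi : injective g by exact: rshift_inj.
move=> v i; rewrite -[v]fintype.splitK; case: (fintype.split v) => j /=; last exact: simplex0.
have vS c : q (lshift (1 + d) j) c = S ord0 c by rewrite col_mxEu mxE.
have [->|i0] := eqVneq i ord0.
  by rewrite /edge_deriv big1 // => c _; rewrite vS gS subrr mul0r.
(* Replacing vertex 0 by the coincident vertex [j] gives another regular simplex, to which
   [simplex0] applies again. *)
pose h l := if l == ord0 then lshift (1 + d) j else g l.
have := @simplex0 h _ _ ord0 i; rewrite /h eqxx (negPf i0); apply.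
  move=> a b; rewrite /h; case: eqP => [->|_]; case: eqP => [->|_] //.
  - by move/eqP; rewrite eq_lrshift.
  - by move/eqP; rewrite eq_rlshift.
  exact: gi.
by move=> a c; rewrite /h; case: eqP => [->|_].
Qed.

Theorem theorem2 (R : realType) (d k n : nat) (hd : (2 <= d)%N)
    (hkn : (k = d - 1 /\ d + 2 <= n)%N
        \/ ((1 <= k)%N /\ (k <= d - 2)%N /\ (d + 1 <= n)%N))
    (p : 'M[R]_(n, d)) (hp : generic p) :
  matroid_rank (rigidity_matroid (complete_complex n k) k p)
    = (d * n - 'C(d + 1, 2))%N.
Proof.
case: hkn => [[-> dn]|[k1 [kd dn]]].
  have nE : n = ((n - d.+2).+1 + (1 + d))%N by lia.
  move: (n - d.+2)%N nE p hp => m nE; subst n => p hp.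
  by rewrite subn1; exact: complete_rank_hyperfaces.
have nE : n = ((n - d.+1) + (1 + d))%N by lia.
move: (n - d.+1)%N nE p hp => m nE; subst n => p hp.
by apply: complete_rank_small_faces => //; lia.
Qed.
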